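(* Let $g(t)=\varphi(t)\,h$ for $t\in[0,1]$, where $\varphi\in AC([0,1])$ is non-decreasing and non-negative and $h$ is a fixed function in $H^1(\Omega)$, and let $K_0\in\mathcal K(\overline\Omega)$. Let $K\colon[0,1]\to\mathcal K(\overline\Omega)$ be a function satisfying: (a) $K_0\subset K(s)\subset K(t)$ for $0\le s\le t\le1$; (b) $\mathcal E(g(0),K(0))\le\mathcal E(g(0),K')$ for all $K'\in\mathcal K(\overline\Omega)$ with $K'\supset K_0$; (c) for $0\le t\le1$, $\mathcal E(g(t),K(t))\le\mathcal E(g(t),K')$ for all $K'\in\mathcal K(\overline\Omega)$ with $K'\supset K(t)$; (d) $t\mapsto\mathcal E(g(t),K(t))$ is absolutely continuous on $[0,1]$; (e) $\frac{d}{ds}\mathcal E(g(t),K(s))\big|_{s=t}=0$ for a.e. $t\in[0,1]$. Then $\mathcal E(g(t),K(t))\le\mathcal E(g(t),K(s))$ for $0\le s<t\le1$.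
   Context: Setting: $\Omega\subset\mathbb R^2$ is a bounded simply connected open set with Lipschitz boundary $\partial\Omega$ (a simple closed curve). $\partial_N\Omega\subset\partial\Omega$ is a fixed (possibly empty) union of finitely many simple open arcs with disjoint closures, $\partial_S\Omega$ is the finite set of end-points of these arcs, and $\partial_D\Omega:=\partial\Omega\setminus(\partial_N\Omega\cup\partial_S\Omega)$. For an open set $A\subset\mathbb R^2$, $L^{1,2}(A):=\{u\in L^2_{loc}(A):\nabla u\in L^2(A;\mathbb R^2)\}$. The capacity of $E\subset\mathbb R^2$ is the infimum of $\int_{\mathbb R^2}(|\nabla u|^2+|u|^2)\,dx$ over $u\in H^1(\mathbb R^2)$ with $u\ge1$ a.e. in a neighbourhood of $E$; ''q.e.'' means except on a set of capacity zero. $\partial_LA$ is the set of points of $\partial A$ near which $A$ is the subgraph of a Lipschitz function (in suitable orthogonal coordinates). Each $u\in L^{1,2}(A)$ is identified with its quasi-continuous representative, defined q.e. on $A\cup\partial_LA$. $\mathcal H^1$ is one-dimensional Hausdorff measure. For a compact set $K\subset\overline\Omega$ and $g\in L^{1,2}(\Omega\setminus K)$, $$\mathcal E(g,K):=\min_{v\in\mathcal V(g,K)}\Big\{\int_{\Omega\setminus K}|\nabla v|^2dx+\mathcal H^1(K)\Big\},\qquad \mathcal V(g,K):=\{v\in L^{1,2}(\Omega\setminus K): v=g\ \text{q.e. on }\partial_D\Omega\setminus K\}.$$ A continuum is a closed connected set (the empty set is allowed); $\mathcal K(\overline\Omega)$ is the set of all continua $K\subset\overline\Omega$ with $\mathcal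 H^1(K)<+\infty$. $AC([0,1])$ is the space of absolutely continuous real functions on $[0,1]$. *)

(* Defs.v *)
From HB Require Import structures.
From mathcomp Require Import all_boot all_order all_algebra.
From mathcomp Require Import all_classical all_reals all_analysis.
Import Order.TTheory GRing.Theory Num.Theory.
Import numFieldNormedType.Exports.

Set Implicit Arguments.
Unset Strict Implicit.
Unset Printing Implicit Defensive.

Local Open Scope classical_set_scope.
Local Open Scope ring_scope.

(* The norm and the product distance of R * R are sup-type.  They are used only
   through the topology (and boundedness) they induce; every metric notion uses
   the Euclidean distance [edist]. *)
Section Plane.
Variable R : realType.
Local Notation plane := (R * R)%type.

Definition dotp (x y : plane) : R := x.1 * y.1 + x.2 * y.2.

Definition edist (x y : plane) : R :=
  Num.sqrt ((x.1 - y.1) ^+ 2 + (x.2 - y.2) ^+ 2).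

Definition leb2 : set (measurableTypeR R * measurableTypeR R) -> \bar R :=
  (@lebesgue_measure R \x @lebesgue_measure R)%E.

Definition bdry (A : set plane) : set plane := closure A `\` A°.

(* [x \in lip_bdry A] iff x is a boundary point near which A is, in the
   orthogonal coordinates given by the orthonormal basis (e1, e2), the subgraph
   of the Lipschitz function f. *)
Definition lip_bdry (A : set plane) : set plane :=
  [set x | bdry A x /\
    exists (e1 e2 : plane) (f : R -> R) (k : R),
      [/\ dotp e1 e1 = 1, dotp e2 e2 = 1, dotp e1 e2 = 0, k.-lipschitz f
        & \forall y \near x, A y <-> dotp y e2 < f (dotp y e1)]].

Definition curve (gam : R -> plane) : Prop := {within `[0, 1], continuous gam}.

Definition simple_closed_curve (C : set plane) : Prop :=
  exists gam : R -> plane,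
    [/\ curve gam, gam 0 = gam 1, {in `[0, 1[ &, injective gam}
      & C = gam @` `[0, 1]].

Definition path_connected (A : set plane) : Prop :=
  forall x y, A x -> A y ->
    exists gam : R -> plane,
      [/\ curve gam, gam 0 = x, gam 1 = y & gam @` `[0, 1] `<=` A].

Definition simply_connected (A : set plane) : Prop :=
  path_connected A /\
  forall gam : R -> plane, curve gam -> gam 0 = gam 1 ->
    gam @` `[0, 1] `<=` A ->
    exists H : R * R -> plane,
      [/\ {within `[0, 1] `*` `[0, 1], continuous H},
          H @` (`[0, 1] `*` `[0, 1]) `<=` A,
          forall t, t \in `[0, 1] -> H (0, t) = gam t,
          forall t, t \in `[0, 1] -> H (1, t) = gam 0
        & forall s, s \in `[0, 1] -> H (s, 0) = gam 0 /\ H (s, 1) = gam 0].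

Definition lipschitz_domain (Om : set plane) : Prop :=
  [/\ open Om, bounded_set Om, simply_connected Om, bdry Om = lip_bdry Om
    & simple_closed_curve (bdry Om)].

(* dN is a finite union of simple open arcs of the boundary of Om with disjoint
   closures, and dS is the set of their end-points. *)
Definition neumann_part (Om dN dS : set plane) : Prop :=
  exists (n : nat) (gam : 'I_n -> R -> plane),
    [/\ forall i, curve (gam i) /\ {in `[0, 1] &, injective (gam i)},
        forall i, gam i @` `]0, 1[ `<=` bdry Om,
        forall i j, i != j ->
          closure (gam i @` `]0, 1[) `&` closure (gam j @` `]0, 1[) = set0,
        dN = \bigcup_(i in [set: 'I_n]) (gam i @` `]0, 1[)
      & dS = \bigcup_(i in [set: 'I_n]) [set gam i 0; gam i 1]].

Definition dirichlet_part (Om dN dS : set plane) : set plane :=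
  bdry Om `\` (dN `|` dS).

(* Sobolev-type spaces *)

Definition D1 (f : plane -> R) (x : plane) : R := 'D_(1, 0) f x.
Definition D2 (f : plane -> R) (x : plane) : R := 'D_(0, 1) f x.

Fixpoint Cn (n : nat) (f : plane -> R) : Prop :=
  continuous f /\
  if n is m.+1 then
    [/\ forall x, derivable f x (1, 0), forall x, derivable f x (0, 1),
        Cn m (D1 f) & Cn m (D2 f)]
  else True.

Definition test_function (A : set plane) (psi : plane -> R) : Prop :=
  [/\ forall n, Cn n psi, compact (closure [set x | psi x != 0])
    & closure [set x | psi x != 0] `<=` A].

Definition sqint (A : set plane) (f : plane -> R) : \bar R :=
  (\int[leb2]_(x in A) (f x ^+ 2)%:E)%E.

Definition dirichlet (A : set plane) (G : plane -> plane) : \bar R :=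
  (\int[leb2]_(x in A) (dotp (G x) (G x))%:E)%E.

Definition L2grad (A : set plane) (u : plane -> R) (G : plane -> plane) :=
  [/\ measurable_fun A (fun x => (G x).1), measurable_fun A (fun x => (G x).2),
      (dirichlet A G < +oo)%E
    & forall psi, test_function A psi ->
        (\int[leb2]_(x in A) (u x * D1 psi x)%:E =
           - \int[leb2]_(x in A) ((G x).1 * psi x)%:E)%E /\
        (\int[leb2]_(x in A) (u x * D2 psi x)%:E =
           - \int[leb2]_(x in A) ((G x).2 * psi x)%:E)%E].

Definition L2loc (A : set plane) (u : plane -> R) : Prop :=
  measurable_fun A u /\
  forall C, compact C -> C `<=` A -> (sqint C u < +oo)%E.

Definition L12 (A : set plane) (u : plane -> R) : Prop :=
  L2loc A u /\ exists G, L2grad A u G.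

Definition H1 (A : set plane) (u : plane -> R) : Prop :=
  [/\ measurable_fun A u, (sqint A u < +oo)%E & exists G, L2grad A u G].

(* Capacity and quasi-continuous representatives *)

Definition capacity (E : set plane) : \bar R :=
  ereal_inf [set c | exists (u : plane -> R) (G : plane -> plane),
    [/\ H1 setT u, L2grad setT u G,
        exists U, [/\ open U, E `<=` U & {ae leb2, forall x, U x -> 1 <= u x}]
      & c = (dirichlet setT G + sqint setT u)%E]].

Definition quasicontinuous (B : set plane) (w : plane -> R) : Prop :=
  forall eps : R, 0 < eps ->
    exists V : set plane,
      (capacity V < eps%:E)%E /\ {within B `\` V, continuous w}.

(* w is the quasi-continuous representative of u on B, for a set B between A
   and its union with its Lipschitz boundary points.  Such a w is unique up to
   sets of capacity zero in B, so on B it is q.e. equal to the representative on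
   the whole of [A `|` lip_bdry A]. *)
Definition qc_representative (A B : set plane) (u w : plane -> R) : Prop :=
  [/\ A `<=` B, B `<=` A `|` lip_bdry A,
      {ae leb2, forall x, A x -> w x = u x} & quasicontinuous B w].

Definition eq_qe (A E : set plane) (u v : plane -> R) : Prop :=
  exists w z : plane -> R,
    [/\ qc_representative A (A `|` E) u w, qc_representative A (A `|` E) v z
      & capacity (E `&` [set x | w x != z x]) = 0%E].

(* One-dimensional Hausdorff measure.  The constant in front of the diameter is
   1, and the diameter of the empty set is 0. *)

Definition diam (E : set plane) : \bar R :=
  ereal_sup (0%E |` [set (edist p.1 p.2)%:E | p in E `*` E]).

Definition hausdorff1_pre (delta : R) (E : set plane) : \bar R :=
  ereal_inf [set (\sum_(0 <= i <oo) diam (F i))%E |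
    F in [set F : nat -> set plane |
      E `<=` \bigcup_i F i /\ forall i, (diam (F i) <= delta%:E)%E]].

Definition hausdorff1 (E : set plane) : \bar R :=
  ereal_sup [set hausdorff1_pre delta E | delta in [set d : R | 0 < d]].

(* The fracture energy *)

(* The minimum over the admissible v is rendered as an infimum. *)
Definition energy (Om dN dS : set plane) (g : plane -> R) (K : set plane)
    : \bar R :=
  ereal_inf [set e | exists (v : plane -> R) (G : plane -> plane),
    [/\ L12 (Om `\` K) v, L2grad (Om `\` K) v G,
        eq_qe (Om `\` K) (dirichlet_part Om dN dS `\` K) v g
      & e = (dirichlet (Om `\` K) G + hausdorff1 K)%E]].

(* [connected set0] holds, so the empty continuum is included. *)
Definition continua (Om : set plane) : set (set plane) :=
  [set K | [/\ closed K, connected K, K `<=` closure Om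
             & (hausdorff1 K < +oo)%E]].

Definition abs_continuous01 (f : R -> R) : Prop :=
  forall eps : R, 0 < eps -> exists2 delta : R, 0 < delta &
    forall (n : nat) (a b : 'I_n -> R),
      (forall i, 0 <= a i /\ a i <= b i /\ b i <= 1) ->
      (forall i j, i != j -> b i <= a j \/ b j <= a i) ->
      \sum_(i < n) (b i - a i) < delta ->
      \sum_(i < n) `|f (b i) - f (a i)| < eps.

End Plane.

(* Main.v *)
Require Import Defs.
From HB Require Import structures.
From mathcomp Require Import all_boot all_order all_algebra.
From mathcomp Require Import all_classical all_reals all_analysis.
From mathcomp Require Import measurable_realfun.
From mathcomp Require Import ring lra.
Import Order.TTheory GRing.Theory Num.Theory.
Import numFieldNormedType.Exports.

Set Implicit Arguments.
Unset Strict Implicit.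

Local Open Scope classical_set_scope.
Local Open Scope ring_scope.

(** Write D(K) for the infimum of the Dirichlet integral over the functions on
    Om \ K with boundary datum h, and l(K) for the length of K.  The problem is
    quadratic in the boundary datum, so the datum c h with c >= 0 has energy
      E(c h, K) = c^2 D(K) + l(K).
    With a(r) = D(K(r)), l(r) = l(K(r)) and F(r) = E(g(r), K(r)) this gives
      F(r) = phi(r)^2 a(r) + l(r),
    and a is non-increasing, since enlarging K(r) only removes constraints.

    Fix s < t.  The stationarity of q |-> phi(r)^2 a(q) + l(q) at q = r says that,
    near almost every r, F varies like phi^2 with the factor a frozen:
      F(v) - F(r) = (phi(v)^2 - phi(r)^2) a(v) + o(v - r).
    As a <= a(s) on [s, t] and phi^2 is non-decreasing, the function
      H(r) = phi(r)^2 a(s) - F(r)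
    has, at almost every r of [s, t], increments bounded below by -o(1) times
    their length.  H is absolutely continuous, hence non-decreasing on [s, t],
    and H(s) <= H(t) reads F(t) <= phi(t)^2 a(s) + l(s) = E(g(t), K(s)).  This is
    [stability_of_stationary_evolution], which rests on the monotonicity
    criterion [abs_continuous01_nondecreasing].

    The formula for E is [energyE] with [bulk_energy_scale], the monotonicity of
    a is [bulk_energy_antitone].  It remains to deal with infinite values of D.
    If D(K(s)) is infinite and phi(t) > 0, then E(g(t), K(s)) is infinite and
    there is nothing to prove.  If phi(t) = 0, then phi vanishes
    on [s, t] and the energies reduce to the lengths, because the zero function
    is admissible for the zero datum.  In the remaining case D(K(r)) is finite
    for all r in [s, t]: competitors restrict to smaller domains, and so do
    their quasi-continuous representatives. *)

(** * Absolutely continuous functions with almost everywhere signed increments *)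

(** Cousin's compactness argument in the form of an induction: the supremum of
    the points reached from s is itself crossed, so it can only be t. *)
Lemma interval_induction {R : realType} (P : R -> Prop) (s t : R) :
  s <= t -> P s ->
  (forall x, s <= x -> x <= t -> exists2 d : R, 0 < d &
    forall u v, s <= u -> u <= x -> x <= v -> v <= t -> v - u < d ->
      P u -> P v) ->
  P t.
Proof.
move=> st Ps step.
pose S : set R := [set x | [/\ s <= x, x <= t & P x]].
have Ss : S s by split.
have Sub : has_sup S by split; [exists s | exists t => x []].
pose z := sup S.
have sz : s <= z by apply: ub_le_sup => //; case: Sub.
have zt : z <= t by apply: ge_sup => [|x []]; [exists s|].
have [d d0 dP] := step z sz zt.
have d20 : 0 < d / 2 by rewrite divr_gt0.
have [u [su ut Pu] zu] := sup_adherent d20 Sub.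
have uz : u <= z by apply: ub_le_sup => //; case: Sub.
have [zt'|zt'] := leP t (z + d / 4).
  by apply: (dP u t) => //; rewrite -/z in zu; lra.
have : P (z + d / 4) by apply: (dP u) => //; rewrite -/z in zu; lra.
move=> Pv; have : z + d / 4 <= z.
  by apply: ub_le_sup => //; [case: Sub|split => //; lra].
by move=> ?; lra.
Qed.

(** Sequences ordered by [pairwise] are easier to extend one interval at a time
    than families indexed by ordinals. *)
Lemma abs_continuous01_seq {R : realType} (H : R -> R) (eps : R) :
  abs_continuous01 H -> 0 < eps -> exists2 delta : R, 0 < delta &
    forall I : seq (R * R),
      (forall p, p \in I -> [/\ 0 <= p.1, p.1 <= p.2 & p.2 <= 1]) ->
      pairwise (fun p q => q.2 <= p.1) I ->
      \sum_(p <- I) (p.2 - p.1) < delta ->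
      \sum_(p <- I) `|H p.2 - H p.1| < eps.
Proof.
move=> acH e0; have [d d0 dP] := acH eps e0; exists d => // I I01 pI sI.
pose a (i : 'I_(size I)) := (nth (0, 0) I i).1.
pose b (i : 'I_(size I)) := (nth (0, 0) I i).2.
have := dP _ a b; rewrite !(big_nth (0, 0)) !big_mkord in sI *.
apply => //.
- by move=> i; have [|] := I01 (nth (0, 0) I i); first exact: mem_nth.
- move=> i j; rewrite neq_ltn => /orP[] ij; [right|left].
    exact: (pairwiseP (0, 0) pI i j (ltn_ord i) (ltn_ord j) ij).
  exact: (pairwiseP (0, 0) pI j i (ltn_ord j) (ltn_ord i) ij).
Qed.

Lemma abs_continuous01_dominated {R : realType} (M : R) (f g H : R -> R) :
  abs_continuous01 f -> abs_continuous01 g ->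
  (forall u v, 0 <= u -> u <= v -> v <= 1 ->
    `|H v - H u| <= M * `|f v - f u| + `|g v - g u|) ->
  abs_continuous01 H.
Proof.
move=> acf acg HM eps e0.
have M0 : 0 < `|M| + 1 by rewrite ltr_wpDl.
have [|df df0 dfP] := acf (eps / 2 / (`|M| + 1)); first by rewrite !divr_gt0.
have [|dg dg0 dgP] := acg (eps / 2); first by rewrite divr_gt0.
exists (Num.min df dg) => [|n a b ab01 abd]; first by rewrite lt_min df0.
rewrite lt_min => /andP[/(dfP _ _ _ ab01 abd) lf /(dgP _ _ _ ab01 abd) lg].
apply: (@le_lt_trans _ _ ((`|M| + 1) * \sum_i `|f (b i) - f (a i)| +
                        \sum_i `|g (b i) - g (a i)|)).
  rewrite mulr_sumr -big_split /=; apply: ler_sum => i _.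
  have [a0 [ab b1]] := ab01 i.
  apply: le_trans (HM _ _ a0 ab b1) _; rewrite lerD2r ler_wpM2r//.
  by have := ler_norm M; lra.
by move: lf; rewrite ltr_pdivlMr// mulrC; lra.
Qed.

(** Cover the exceptional set N by an open set U of measure below the threshold
    that absolute continuity provides for eps / 2.  Moving from s to t by short
    steps, each around a point x of [s, t], H loses at most eps / 2 times the
    length of a step when x is outside N, and the steps around points of N
    lie in U, so that their total loss is below eps / 2. *)
Lemma abs_continuous01_nondecreasing {R : realType} (H : R -> R) (N : set R)
    (s t : R) :
  abs_continuous01 H -> 0 <= s -> s <= t -> t <= 1 ->
  (@lebesgue_measure R).-negligible N ->
  (forall x, s <= x -> x <= t -> ~ N x ->
     forall eps : R, 0 < eps -> exists2 d : R, 0 < d &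
       forall u v, s <= u -> u <= x -> x <= v -> v <= t -> v - u < d ->
         - (eps * (v - u)) <= H v - H u) ->
  H s <= H t.
Proof.
move=> acH s0 st t1 [A [mA A0 NA]] good.
suff main (eps : R) : 0 < eps -> H s <= H t + eps.
  by apply/ler_addgt0Pr => e e0; exact: main.
move=> e0.
have e20 : 0 < eps / 2 by rewrite divr_gt0.
have [delta delta0 deltaP] := abs_continuous01_seq acH e20.
have Aoo : (lebesgue_measure A < +oo)%E by rewrite A0.
have [U [oU AU UA]] := lebesgue_regularity_outer mA Aoo delta0.
have mU : measurable U by exact: open_measurable.
have Ud : (lebesgue_measure U < delta%:E)%E.
  rewrite -(setDKU AU) measureU ?setDKI//; last exact: measurableD.
  by rewrite [X in (_ + X)%E]A0 adde0.
pose m x := (@lebesgue_measure R) (U `&` `]s, x]).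
have mUx x : measurable (U `&` `]s, x]) by exact: measurableI.
have m_le u v : u <= v -> (m u <= m v)%E.
  move=> uv; apply: le_measure.
  - by rewrite inE; exact: mUx.
  - by rewrite inE; exact: mUx.
  move=> y [Uy /= /[!in_itv]/= /andP[sy yu]].
  by split => //; lra.
(* I lists the steps made inside U on the way from s to x; bounding their total
   length by the measure of U in ]s, x] is what survives adding one more step. *)
pose P x := exists I : seq (R * R), [/\
  (forall p, p \in I -> [/\ s <= p.1, p.1 <= p.2 & p.2 <= x]),
  pairwise (fun p q => q.2 <= p.1) I,
  ((\sum_(p <- I) (p.2 - p.1))%:E <= m x)%E &
  - (eps / 2 * (x - s)) - \sum_(p <- I) `|H p.2 - H p.1| <= H x - H s].
have [I [I01 pI sI HI]] : P t.
  apply: (@interval_induction _ P s t) => //.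
    exists [::]; split => //; rewrite ?big_nil//.
    by rewrite !subrr mulr0 oppr0 addr0.
  move=> x sx xt; have [Nx|Nx] := pselect (N x).
    have := open_nbhs_nbhs (conj oU (AU x (NA x Nx))).
    rewrite -nbhs_ballE => -[d /= d0 xdU]; exists d => // u v su ux xv vt uvd.
    move=> [I [Iu pI sI HI]]; exists ((u, v) :: I); split.
    - move=> p; rewrite inE => /orP[/eqP->/=|/Iu[sp pp pu]].
        by split => //; exact: le_trans xv.
      by split => //; apply: le_trans pu _; exact: le_trans xv.
    - rewrite pairwise_cons pI andbT; apply/allP => p /Iu[_ _]; exact.
    - rewrite big_cons/= addrC EFinD; apply: le_trans (leeD2r _ sI) _.
      have uvE : (v - u)%:E = (@lebesgue_measure R) `]u, v].
        rewrite lebesgue_measure_itv/= lte_fin; case: ltP => //.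
        by move=> vu; rewrite (_ : v = u) ?subrr//; lra.
      rewrite /m uvE -measureU//; last 2 first.
      + exact: mUx.
      + apply/seteqP; split => // y [[_] /=].
        by rewrite !in_itv/= => /andP[_ yu] /andP[uy _]; lra.
      apply: le_measure.
      + by rewrite inE; apply: measurableU => //; exact: mUx.
      + by rewrite inE; exact: mUx.
      move=> y [[Uy]|] /=; rewrite !in_itv/= => /andP[sy yu].
        by split => //; lra.
      split; last by lra.
      by apply: xdU; rewrite /ball/= ltr_norml; lra.
    - rewrite big_cons/=.
      have := ler_norm (- (H v - H u)); rewrite normrN.
      have : 0 <= eps / 2 * (v - u) by rewrite mulr_ge0; lra.
      by lra.
  have [d d0 dP] := good x sx xt Nx _ e20; exists d => // u v su ux xv vt uvd.
  move=> [I [Iu pI sI HI]]; exists I; split => //.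
  - by move=> p /Iu[sp pp pu]; split => //; lra.
  - by apply: le_trans sI _; apply: m_le; lra.
  - by have := dP u v su ux xv vt uvd; lra.
have Hsmall : \sum_(p <- I) `|H p.2 - H p.1| < eps / 2.
  apply: deltaP => //; first by move=> p /I01[sp pp pt]; split; lra.
  rewrite -lte_fin; apply: le_lt_trans sI _; apply: le_lt_trans Ud.
  apply: le_measure; [by rewrite inE; exact: mUx|by rewrite inE|].
  exact: subIsetl.
have : eps / 2 * (t - s) <= eps / 2 * 1 by rewrite ler_wpM2l; lra.
by lra.
Qed.

Lemma is_derive0_bound {R : realType} (f : R -> R) (x eps : R) :
  is_derive x (1 : R) f 0 -> 0 < eps ->
  exists2 d : R, 0 < d & forall y, `|y - x| < d ->
    `|f y - f x| <= eps * `|y - x|.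
Proof.
move=> [/cvg_ex[/= l dl] Df] e0.
have l0 : l = 0 by rewrite -Df; apply/esym/cvg_lim.
rewrite l0 in dl; have /cvgr0_norm_le/(_ _ e0) [d /= d0 dP] := dl.
exists d => // y yx.
have [->|yNx] := eqVneq y x; first by rewrite !subrr normr0 mulr0.
have yx0 : y - x != 0 by rewrite subr_eq0.
have := dP (y - x); rewrite /= sub0r normrN => /(_ yx yx0).
rewrite /GRing.scale/= mulr1 subrK normrM normfV mulrC ler_pdivrMr//.
by rewrite normr_gt0.
Qed.

(** The real-variable content of the theorem, with f p q in the role of the
    energy of the datum phi(p) h and the crack K(q).  Up to o(1) times their
    length, the increments of phi^2 a(s) - f r r around r are increments of
    phi^2 times differences a(s) - a(q), hence non-negative. *)
Lemma stability_of_stationary_evolution {R : realType} (phi a l : R -> R)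
    (f : R -> R -> R) (s t : R) :
  abs_continuous01 phi ->
  (forall p q, 0 <= p -> p <= q -> q <= 1 -> phi p <= phi q) ->
  (forall p, 0 <= p -> p <= 1 -> 0 <= phi p) ->
  0 <= s -> s <= t -> t <= 1 ->
  (forall p q, s <= p <= t -> s <= q <= t ->
     f p q = phi p ^+ 2 * a q + l q) ->
  (forall r, s <= r <= t -> a r <= a s) ->
  abs_continuous01 (fun r => f r r) ->
  {ae (@lebesgue_measure R), forall r : R, 0 <= r /\ r <= 1 ->
    is_derive r (1 : R) (f r) (0 : R)} ->
  f t t <= f t s.
Proof.
move=> acphi phi_nd phi_ge0 s0 st t1 fE a_le acf df.
pose H r := phi r ^+ 2 * a s - f r r.
suff : H s <= H t by rewrite /H !fE ?lexx ?st//; lra.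
apply: (@abs_continuous01_nondecreasing _ H) df _ => //.
  apply: (@abs_continuous01_dominated _ (phi 1 * 2 * `|a s|) phi
    (fun r => f r r)) => // u v u0 uv v1.
  have -> : H v - H u =
      a s * (phi v + phi u) * (phi v - phi u) - (f v v - f u u).
    by rewrite /H; ring.
  apply: le_trans (ler_normB _ _) _; rewrite lerD2r !normrM ler_wpM2r//.
  rewrite mulrC ler_wpM2r//.
  have := phi_ge0 u u0 (le_trans uv v1).
  have := phi_nd u v u0 uv v1.
  have := phi_nd v 1 (le_trans u0 uv) v1 (lexx _).
  by move=> ? ? ?; rewrite ger0_norm; lra.
move=> x sx xt /contrapT dfx eps e0.
have [|d d0 dP] := @is_derive0_bound _ (f x) x eps _ e0.
  by apply: dfx; lra.
have sqr_le p q : s <= p -> p <= q -> q <= t -> phi p ^+ 2 <= phi q ^+ 2.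
  by move=> sp pq qt; rewrite lerXn2r ?nnegrE ?phi_nd ?phi_ge0//; lra.
exists d => // u v su ux xv vt uvd.
have fu : `|f x u - f x x| <= eps * (x - u).
  by rewrite -[x - u]ger0_norm ?subr_ge0// (distrC x); apply: dP;
    rewrite distrC ger0_norm; lra.
have fv : `|f x v - f x x| <= eps * (v - x).
  by rewrite -[v - x]ger0_norm ?subr_ge0//; apply: dP; rewrite ger0_norm; lra.
(* Freezing the first argument at x leaves these two products as the exact
   discrepancy between the increments of H and those of f x. *)
have pv : 0 <= (phi v ^+ 2 - phi x ^+ 2) * (a s - a v).
  by rewrite mulr_ge0 ?subr_ge0 ?sqr_le ?a_le//; lra.
have pu : 0 <= (phi x ^+ 2 - phi u ^+ 2) * (a s - a u).
  by rewrite mulr_ge0 ?subr_ge0 ?sqr_le ?a_le//; lra.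
have su' : s <= u <= t by lra.
have sv' : s <= v <= t by lra.
have sx' : s <= x <= t by lra.
move: fu fv; rewrite /H !ler_norml => /andP[fu _] /andP[_ fv].
move: fu fv; rewrite !fE//; lra.
Qed.

(** * Measurability in the plane *)

(** The plane carries the product sigma-algebra; that it contains the open sets
    comes from the countably many open rectangles with rational corners. *)
Lemma open_measurable_plane {R : realType} (U : set (R * R)) :
  open U -> measurable U.
Proof.
move=> oU.
pose box (q : rat * rat * (rat * rat)) : set (R * R) :=
  `]ratr q.1.1, ratr q.1.2[ `*` `]ratr q.2.1, ratr q.2.2[.
pose F q := if `[< box q `<=` U >] then box q else set0.
have -> : U = \bigcup_q F q.
  apply/seteqP; split => [[x y] Uxy|p [q _]]; last first.
    by rewrite /F; case: asboolP => // bU; exact: bU.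
  have := open_nbhs_nbhs (conj oU Uxy).
  rewrite -nbhs_ballE => -[e /= e0 eU].
  have rat_near (z : R) : exists a b : rat,
      [/\ z - e < ratr a, ratr a < z, z < ratr b & ratr b < z + e].
    have [|a] := @rat_in_itvoo R (z - e) z; first by lra.
    have [|b] := @rat_in_itvoo R z (z + e); first by lra.
    rewrite !in_itv/= => /andP[? ?] /andP[? ?]; by exists a, b; split.
  have [a [b [xa ax xb bx]]] := rat_near x.
  have [c [d [yc cy yd dy]]] := rat_near y.
  exists ((a, b), (c, d)) => //; rewrite /F asboolT.
    by split; rewrite /= in_itv/=; lra.
  move=> [x' y'] [/=]; rewrite !in_itv/= => xx yy; apply: eU.
  by split; rewrite /ball/= ltr_norml; lra.
apply: countable_bigcupT_measurable => [|q]; first exact: countableP.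
rewrite /F; case: asboolP => // _.
by apply: measurableX; exact: measurable_itv.
Qed.

Lemma compact_measurable_plane {R : realType} (C : set (R * R)) :
  compact C -> measurable C.
Proof.
move=> kC; rewrite -(setCK C); apply: measurableC.
apply: open_measurable_plane; apply: closed_openC.
by apply: compact_closed => //; exact: norm_hausdorff.
Qed.

Section Energies.
Variable R : realType.
Local Notation plane := (R * R)%type.
Implicit Types (A B E K : set plane) (u v w psi : plane -> R).
Implicit Types (G : plane -> plane) (c : R).

(** * Restriction and scaling of weakly differentiable functions *)

Lemma dotp_ge0 (x : plane) : 0 <= dotp x x.
Proof. by rewrite addr_ge0// -expr2 sqr_ge0. Qed.

Lemma measurable_dotp A G :
  measurable_fun A (fun x => (G x).1) -> measurable_fun A (fun x => (G x).2) ->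
  measurable_fun A (fun x => (dotp (G x) (G x))%:E).
Proof.
move=> m1 m2; apply/measurable_EFinP.
by apply: measurable_funD; exact: measurable_funM.
Qed.

Lemma dirichlet_ge0 A G : (0 <= dirichlet A G)%E.
Proof. by apply: integral_ge0 => x _; rewrite lee_fin dotp_ge0. Qed.

Lemma dirichlet_subset A B G : open A -> open B -> A `<=` B ->
  measurable_fun B (fun x => (G x).1) -> measurable_fun B (fun x => (G x).2) ->
  (dirichlet A G <= dirichlet B G)%E.
Proof.
move=> oA oB AB m1 m2; apply: ge0_subset_integral => //.
- exact: open_measurable_plane.
- exact: open_measurable_plane.
- exact: measurable_dotp.
- by move=> x _; rewrite lee_fin dotp_ge0.
Qed.

Lemma dirichlet_scale A G c : open A ->
  measurable_fun A (fun x => (G x).1) -> measurable_fun A (fun x => (G x).2) ->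
  dirichlet A (fun x => (c * (G x).1, c * (G x).2)) =
  ((c ^+ 2)%:E * dirichlet A G)%E.
Proof.
move=> oA m1 m2; rewrite /dirichlet -ge0_integralZl//.
- by apply: eq_integral => x _; rewrite -EFinM /dotp/=; congr EFin; ring.
- exact: open_measurable_plane.
- exact: measurable_dotp.
- by move=> x _; rewrite lee_fin dotp_ge0.
- by rewrite lee_fin sqr_ge0.
Qed.

Lemma sqint_scale A u c : measurable A -> measurable_fun A u ->
  sqint A (fun x => c * u x) = ((c ^+ 2)%:E * sqint A u)%E.
Proof.
move=> mA mu; rewrite /sqint -ge0_integralZl//.
- by apply: eq_integral => x _; rewrite -EFinM exprMn.
- by apply/measurable_EFinP; exact: measurable_funX.
- by move=> x _; rewrite lee_fin sqr_ge0.
- by rewrite lee_fin sqr_ge0.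
Qed.

Lemma Cn_scale n c psi : Cn n psi -> Cn n (fun x => c * psi x).
Proof.
elim: n psi => [|n IH] psi /= [cpsi].
  by split=> // x; apply: cvgM; [exact: cvg_cst|exact: cpsi].
move=> [d1 d2 C1 C2].
have dZ (e : plane) : (forall x, derivable psi x e) ->
    (fun x => 'D_e (fun y => c * psi y) x) = (fun x => c * 'D_e psi x).
  by move=> de; apply/funext => x; exact: deriveZ.
split; first by move=> x; apply: cvgM; [exact: cvg_cst|exact: cpsi].
split.
- by move=> x; exact: derivableZ.
- by move=> x; exact: derivableZ.
- by rewrite /D1 dZ//; exact: IH.
- by rewrite /D2 dZ//; exact: IH.
Qed.

Lemma test_function_scale A c psi : c != 0 ->
  test_function A psi -> test_function A (fun x => c * psi x).
Proof.
move=> c0 [Cpsi kpsi sA].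
have E : [set x | c * psi x != 0] = [set x | psi x != 0].
  by apply/seteqP; split => x /=; rewrite mulf_eq0 (negbTE c0).
by split; rewrite ?E// => n; exact: Cn_scale.
Qed.

(** The partial derivatives vanish as well because the function vanishes near x,
    the support being closed. *)
Lemma test_function_vanish A psi x : test_function A psi -> ~ A x ->
  [/\ psi x = 0, D1 psi x = 0 & D2 psi x = 0].
Proof.
move=> [_ _ sA] nAx.
have near0 : \near x, psi x = cst 0 x.
  have : open_nbhs x (~` closure [set x | psi x != 0]).
    by split; [exact/closed_openC/closed_closure|move=> /sA].
  move=> /open_nbhs_nbhs; apply: filterS => y ny /=.
  by apply/eqP/negP => /negP py; apply: ny; exact: subset_closure.
split; first exact: (nbhs_singleton near0).
  by rewrite /D1 (near_eq_derive _ near0) derive_cst.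
by rewrite /D2 (near_eq_derive _ near0) derive_cst.
Qed.

Lemma integral_support A B (f : plane -> R) : A `<=` B ->
  (forall x, ~ A x -> f x = 0) ->
  (\int[@leb2 R]_(x in B) (f x)%:E = \int[@leb2 R]_(x in A) (f x)%:E)%E.
Proof.
move=> AB f0; rewrite integral_mkcond [RHS]integral_mkcond.
congr integral; apply/funext => x; rewrite !patchE.
have [Ax|nAx] := pselect (A x).
  by rewrite !mem_set//; exact: AB.
by rewrite (memNset nAx) f0//; case: ifP.
Qed.

Lemma L2grad_subset A B u G : open A -> open B -> A `<=` B ->
  L2grad B u G -> L2grad A u G.
Proof.
move=> oA oB AB [m1 m2 fin ibp]; split.
- by apply: measurable_funS m1 => //; exact: open_measurable_plane.
- by apply: measurable_funS m2 => //; exact: open_measurable_plane.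
- by apply: le_lt_trans fin; exact: dirichlet_subset.
- move=> psi tpsi; have tB : test_function B psi.
    by case: tpsi => ? ? sA; split => //; exact: subset_trans AB.
  have v0 x : ~ A x -> [/\ psi x = 0, D1 psi x = 0 & D2 psi x = 0].
    exact: test_function_vanish.
  have [i1 i2] := ibp psi tB.
  split.
    by move: i1; rewrite !(integral_support AB)// => x /v0[p0 d1 d2];
      rewrite ?p0 ?d1 mulr0.
  by move: i2; rewrite !(integral_support AB)// => x /v0[p0 d1 d2];
    rewrite ?p0 ?d2 mulr0.
Qed.

(** The constant is moved onto the test function: pulling it out of the
    integrals of u would call for the integrability of u times a derivative of
    psi, which [L2grad] does not contain. *)
Lemma L2grad_scale A u G c : open A -> c != 0 -> L2grad A u G ->
  L2grad A (fun x => c * u x) (fun x => (c * (G x).1, c * (G x).2)).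
Proof.
move=> oA c0 [m1 m2 fin ibp]; split.
- exact: measurable_funM.
- exact: measurable_funM.
- by rewrite dirichlet_scale// lte_mul_pinfty// lee_fin sqr_ge0.
- move=> psi tpsi; have [i1 i2] := ibp _ (test_function_scale c0 tpsi).
  case: tpsi => Cpsi _ _; have [_ [d1 d2 _ _]] := Cpsi 1%N.
  split.
    transitivity (\int[@leb2 R]_(x in A)
        (u x * D1 (fun y => c * psi y) x)%:E)%E.
      apply: eq_integral => x _; rewrite /D1 (deriveZ c (d1 x)).
      by rewrite /GRing.scale/= mulrCA mulrA.
    rewrite i1; congr (- _)%E; apply: eq_integral => x _ /=.
    by rewrite mulrCA mulrA.
  transitivity (\int[@leb2 R]_(x in A)
      (u x * D2 (fun y => c * psi y) x)%:E)%E.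
    apply: eq_integral => x _; rewrite /D2 (deriveZ c (d2 x)).
    by rewrite /GRing.scale/= mulrCA mulrA.
  rewrite i2; congr (- _)%E; apply: eq_integral => x _ /=.
  by rewrite mulrCA mulrA.
Qed.

Lemma L12_subset A B u : open A -> open B -> A `<=` B ->
  L12 B u -> L12 A u.
Proof.
move=> oA oB AB [[mu u2] [G uG]]; split; last first.
  by exists G; exact: L2grad_subset uG.
split; first by apply: measurable_funS mu => //; exact: open_measurable_plane.
by move=> C kC CA; apply: u2 => //; exact: subset_trans AB.
Qed.

Lemma L12_scale A u c : open A -> c != 0 -> L12 A u ->
  L12 A (fun x => c * u x).
Proof.
move=> oA c0 [[mu u2] [G uG]]; split; last first.
  by exists (fun x => (c * (G x).1, c * (G x).2)); exact: L2grad_scale.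
split; first exact: measurable_funM.
move=> C kC CA; have mC := compact_measurable_plane kC.
rewrite sqint_scale//; last first.
  by apply: measurable_funS mu => //; exact: open_measurable_plane.
by rewrite lte_mul_pinfty ?lee_fin ?sqr_ge0//; exact: u2.
Qed.

Lemma dirichlet0 A : dirichlet A (cst 0) = 0%E.
Proof.
by apply: integral0_eq => x _; rewrite /dotp/= mulr0 addr0.
Qed.

Lemma sqint0 A : sqint A (cst 0) = 0%E.
Proof. by apply: integral0_eq => x _; rewrite /= expr0n. Qed.

Lemma L2grad0 A : L2grad A (cst 0) (cst 0).
Proof.
split => //=; first by rewrite dirichlet0.
move=> psi _; split; rewrite !integral0_eq ?oppe0// => x _ /=;
  by rewrite mul0r.
Qed.

Lemma L12_0 A : L12 A (cst 0).
Proof.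
split; last by exists (cst 0); exact: L2grad0.
by split => // C _ _; rewrite sqint0.
Qed.

(** * Capacity and boundary values *)

Lemma capacity_ge0 E : (0 <= capacity E)%E.
Proof.
apply: le_ereal_inf_tmp => _ [u [G [_ _ _ ->]]].
by rewrite adde_ge0 ?dirichlet_ge0//; apply: integral_ge0 => x _;
  rewrite lee_fin sqr_ge0.
Qed.

Lemma capacity_le A B : A `<=` B -> (capacity A <= capacity B)%E.
Proof.
move=> AB; apply: ereal_inf_le_tmp => _ [u [G [Hu uG [U [oU BU U1]] ->]]].
exists u, G; split => //; exists U; split => //; exact: subset_trans BU.
Qed.

Lemma capacity0 : capacity (@set0 plane) = 0%E.
Proof.
apply/eqP; rewrite eq_le capacity_ge0 andbT; apply: ereal_inf_lbound.
exists (cst 0), (cst 0); split.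
- split => //; first by rewrite sqint0.
  by exists (cst 0); exact: L2grad0.
- exact: L2grad0.
- by exists set0; split; [exact: open0| |exact: aeW].
- by rewrite dirichlet0 sqint0 adde0.
Qed.

Lemma ae_leb2_mono (P Q : set plane) : P `<=` Q ->
  {ae @leb2 R, forall x, P x} -> {ae @leb2 R, forall x, Q x}.
Proof.
move=> PQ [N [mN N0 PN]]; exists N; split => //.
by apply: subset_trans PN => x; apply: contra_not; exact: PQ.
Qed.

(** The condition on E' is the only one that does not restrict by itself: on the
    smaller domain the points of E' have to be Lipschitz boundary points again,
    which [lip_bdry_setD] provides away from the set removed. *)
Lemma qc_representative_subset A A' E E' u w :
  A' `<=` A -> E' `<=` E -> E' `<=` lip_bdry A' ->
  qc_representative A (A `|` E) u w ->
  qc_representative A' (A' `|` E') u w.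
Proof.
move=> AA EE El [_ _ wu qw]; split.
- exact: subsetUl.
- exact: setUS.
- by apply: ae_leb2_mono wu => x /= wu Ax; apply: wu; exact: AA.
- move=> eps /qw[V [cV wV]]; exists V; split => //.
  by apply: continuous_subspaceW wV; apply: setSD; exact: setUSS.
Qed.

Lemma eq_qe_subset A A' E E' u v :
  A' `<=` A -> E' `<=` E -> E' `<=` lip_bdry A' ->
  eq_qe A E u v -> eq_qe A' E' u v.
Proof.
move=> AA EE El [w [z [uw vz wz]]]; exists w, z.
split; [exact: qc_representative_subset uw|exact: qc_representative_subset vz|].
apply/eqP; rewrite eq_le capacity_ge0 andbT -wz.
by apply: capacity_le; exact: setSI.
Qed.

Lemma qc_representative_scale A B u w c : qc_representative A B u w ->
  qc_representative A B (fun x => c * u x) (fun x => c * w x).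
Proof.
move=> [AB Bl wu qw]; split => //.
  by apply: ae_leb2_mono wu => x /= wu Ax; rewrite wu.
move=> eps /qw[V [cV wV]]; exists V; split => //.
by move=> x; apply: cvgM; [exact: cvg_cst|exact: wV].
Qed.

Lemma eq_qe_scale A E u v c : c != 0 ->
  eq_qe A E u v -> eq_qe A E (fun x => c * u x) (fun x => c * v x).
Proof.
move=> c0 [w [z [uw vz wz]]]; exists (fun x => c * w x), (fun x => c * z x).
split; [exact: qc_representative_scale|exact: qc_representative_scale|].
rewrite -wz; congr (capacity (_ `&` _)); apply/seteqP; split => x /=.
  by apply: contra_neq => ->.
by apply: contra_neq => /(mulfI c0).
Qed.

Lemma eq_qe0 A E : E `<=` lip_bdry A -> eq_qe A E (cst 0) (cst 0).
Proof.
move=> El; exists (cst 0), (cst 0).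
have qc0 : qc_representative A (A `|` E) (cst 0 : plane -> R) (cst 0).
  split; [exact: subsetUl|exact: setUS|exact: aeW|].
  move=> eps e0; exists set0; rewrite capacity0; split => //.
  by apply: continuous_subspaceT; exact: cst_continuous.
split => //; rewrite (_ : _ `&` _ = set0) ?capacity0//.
by apply/seteqP; split => // x [_] /=; rewrite eqxx.
Qed.

(** Being a Lipschitz boundary point is local, and A \ K agrees with A near a
    point off the closed set K. *)
Lemma lip_bdry_setD A K x : closed K -> lip_bdry A x -> ~ K x ->
  lip_bdry (A `\` K) x.
Proof.
move=> cK [[clA iA] [e1 [e2 [f [k [n1 n2 n12 lf nA]]]]]] nK.
have nbK : nbhs x (~` K).
  by apply: open_nbhs_nbhs; split => //; exact: closed_openC.
split; first split.
- move=> B nB; have [y [Ay [By Ky]]] := clA _ (filterI nB nbK).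
  by exists y; split.
- by apply: contra_not iA; apply: interiorS; exact: subDsetl.
- exists e1, e2, f, k; split => //; move: nbK nA; apply: filterS2 => y nKy <-.
  by split => [[]|].
Qed.

(** * The bulk energy *)

Variables Om dN dS : set plane.

Definition bulk_energy u K : \bar R :=
  ereal_inf [set e | exists v G,
    [/\ L12 (Om `\` K) v, L2grad (Om `\` K) v G,
        eq_qe (Om `\` K) (dirichlet_part Om dN dS `\` K) v u
      & e = dirichlet (Om `\` K) G]].

Hypothesis lipOm : lipschitz_domain Om.

Lemma open_setD_closed K : closed K -> open (Om `\` K).
Proof.
by case: lipOm => oOm _ _ _ _ cK; apply: openI => //; exact: closed_openC.
Qed.

Lemma dirichlet_part_lip_bdry K : closed K ->
  dirichlet_part Om dN dS `\` K `<=` lip_bdry (Om `\` K).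
Proof.
case: lipOm => _ _ _ bE _ cK x [[bx _] nK].
by apply: lip_bdry_setD => //; rewrite -bE.
Qed.

Lemma bulk_energy_ge0 u K : (0 <= bulk_energy u K)%E.
Proof.
by apply: le_ereal_inf_tmp => _ [v [G [_ _ _ ->]]]; exact: dirichlet_ge0.
Qed.

(** Removing more from the domain restricts competitors and shortens the
    integral. *)
Lemma bulk_energy_antitone u K K' : closed K -> closed K' -> K `<=` K' ->
  (bulk_energy u K' <= bulk_energy u K)%E.
Proof.
move=> cK cK' KK; apply: le_ereal_inf_tmp => _ [v [G [v12 vG vu ->]]].
have oK := open_setD_closed cK; have oK' := open_setD_closed cK'.
have AA : Om `\` K' `<=` Om `\` K by exact: setDS.
apply: ge_ereal_inf; exists (dirichlet (Om `\` K') G).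
  exists v, G; split => //; [exact: L12_subset v12|exact: L2grad_subset vG|].
  apply: eq_qe_subset vu => //; first exact: setDS.
  exact: dirichlet_part_lip_bdry.
by case: vG => m1 m2 _ _; exact: dirichlet_subset.
Qed.

Lemma bulk_energy_scale_le u K c : closed K -> 0 < c ->
  (bulk_energy (fun x => c * u x)%R K <= (c ^+ 2)%:E * bulk_energy u K)%E.
Proof.
move=> cK c0; have oK := open_setD_closed cK.
have c20 : 0 < c ^+ 2 by rewrite exprn_gt0.
rewrite -lee_pdivrMl//; apply: le_ereal_inf_tmp => _ [v [G [v12 vG vu ->]]].
rewrite lee_pdivrMl//; apply: ereal_inf_lbound.
have c1 : c != 0 by rewrite gt_eqF.
exists (fun x => c * v x), (fun x => (c * (G x).1, c * (G x).2)).
split; [exact: L12_scale|exact: L2grad_scale|exact: eq_qe_scale|].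
by case: vG => m1 m2 _ _; rewrite dirichlet_scale.
Qed.

(** For c > 0 multiplication by c is a bijection between competitors for u and
    for c u.  For c = 0 the right-hand side is 0 even if u has no competitor,
    as 0 * +oo = 0; the left-hand side is 0 because the zero function competes. *)
Lemma bulk_energy_scale u K c : closed K -> 0 <= c ->
  bulk_energy (fun x => c * u x) K = ((c ^+ 2)%:E * bulk_energy u K)%E.
Proof.
move=> cK; rewrite le_eqVlt => /orP[/eqP<-|c0].
  rewrite expr0n mul0e; apply/eqP; rewrite eq_le bulk_energy_ge0 andbT.
  apply: ereal_inf_lbound; exists (cst 0), (cst 0); rewrite dirichlet0.
  split => //; [exact: L12_0|exact: L2grad0|].
  rewrite (_ : (fun x => 0 * u x) = cst 0); last first.
    by apply/funext => x; rewrite mul0r.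
  by apply: eq_qe0; exact: dirichlet_part_lip_bdry.
apply/eqP; rewrite eq_le bulk_energy_scale_le//=.
have c20 : 0 < c ^+ 2 by rewrite exprn_gt0.
have ci0 : 0 < c^-1 by rewrite invr_gt0.
rewrite -lee_pdivlMl//.
have := bulk_energy_scale_le (fun x => c * u x) cK ci0.
rewrite exprVn; under eq_fun do rewrite mulKf ?gt_eqF//.
done.
Qed.

Lemma hausdorff1_ge0 K : (0 <= hausdorff1 K)%E.
Proof.
have d0 E : (0 <= diam E)%E by apply: ereal_sup_ubound; left.
apply: (@le_trans _ _ (hausdorff1_pre 1 K)).
  by apply: le_ereal_inf_tmp => _ [F _ <-]; exact: nneseries_ge0.
by apply: ereal_sup_ubound; exists 1 => //=.
Qed.

Lemma energyE u K : (hausdorff1 K < +oo)%E ->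
  energy Om dN dS u K = (bulk_energy u K + hausdorff1 K)%E.
Proof.
move=> Koo; have Kfin : hausdorff1 K \is a fin_num.
  by rewrite ge0_fin_numE// hausdorff1_ge0.
apply/eqP; rewrite eq_le; apply/andP; split.
  rewrite -leeBlDr//; apply: le_ereal_inf_tmp => _ [v [G [v12 vG vu ->]]].
  by rewrite leeBlDr//; apply: ereal_inf_lbound; exists v, G.
apply: le_ereal_inf_tmp => _ [v [G [v12 vG vu ->]]]; rewrite leeD2r//.
by apply: ereal_inf_lbound; exists v, G.
Qed.

End Energies.

(** * The stability inequality *)

Theorem proposition7p14 (R : realType) (Om dN dS : set (R * R))
  (hOm : lipschitz_domain Om) (hN : neumann_part Om dN dS)
  (phi : R -> R) (h : R * R -> R) (K0 : set (R * R)) (K : R -> set (R * R))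
  (phi_ac : abs_continuous01 phi)
  (phi_nd : forall s t : R, 0 <= s -> s <= t -> t <= 1 -> phi s <= phi t)
  (phi_ge0 : forall t : R, 0 <= t -> t <= 1 -> 0 <= phi t)
  (h_H1 : H1 Om h)
  (hK0 : continua Om K0)
  (hK : forall t : R, 0 <= t -> t <= 1 -> continua Om (K t)) :
  let g := fun (t : R) (x : R * R) => phi t * h x in
  let E := energy Om dN dS in
  forall
  (ha : forall s t : R, 0 <= s -> s <= t -> t <= 1 ->
          K0 `<=` K s /\ K s `<=` K t)
  (hb : forall K', continua Om K' -> K0 `<=` K' ->
          (E (g 0%R) (K 0%R) <= E (g 0%R) K')%E)
  (hc : forall t : R, 0 <= t -> t <= 1 ->
          forall K', continua Om K' -> K t `<=` K' ->
          (E (g t) (K t) <= E (g t) K')%E)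
  (hd : abs_continuous01 (fun t => fine (E (g t) (K t))))
  (he : {ae (@lebesgue_measure R), forall t : R, 0 <= t /\ t <= 1 ->
          is_derive t (1 : R) (fun s : R => fine (E (g t) (K s))) (0 : R)}),
  forall s t : R, 0 <= s -> s < t -> t <= 1 ->
    (E (g t) (K t) <= E (g t) (K s))%E.
Proof.
move=> g E ha hb hc hd he s t s0 st t1.
have K_cont r : s <= r <= t -> closed (K r) /\ (hausdorff1 (K r) < +oo)%E.
  by move=> srt; case: (hK r) => //; lra.
pose D r := bulk_energy Om dN dS h (K r).
pose l r := fine (hausdorff1 (K r)).
have EE p q : s <= p <= t -> s <= q <= t ->
    E (g p) (K q) = ((phi p ^+ 2)%:E * D q + (l q)%:E)%E.
  move=> spt sqt; have [cK Koo] := K_cont q sqt.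
  rewrite /E energyE// bulk_energy_scale//; last by apply: phi_ge0; lra.
  by rewrite /l fineK// ge0_fin_numE// hausdorff1_ge0.
have stt : s <= t <= t by lra.
have sst : s <= s <= t by lra.
(* In the second alternative a is 0 if phi vanishes on [s, t], and the real
   value of D otherwise. *)
suff [->|[a [a_le aE]]] : E (g t) (K s) = +oo%E \/
    exists a : R -> R, (forall r, s <= r <= t -> a r <= a s) /\
    forall p q, s <= p <= t -> s <= q <= t ->
      E (g p) (K q) = (phi p ^+ 2 * a q + l q)%:E.
- exact: leey.
- have := @stability_of_stationary_evolution _ phi a l
    (fun p q => fine (E (g p) (K q))) s t phi_ac phi_nd phi_ge0 s0 (ltW st) t1.
  rewrite !aE// lee_fin /=; apply => // p q spt sqt.
  by rewrite aE.
have phi_t0 : 0 <= phi t by apply: phi_ge0; lra.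
have [pt0|pt0] := eqVneq (phi t) 0.
  right; exists (cst 0); split => // p q spt sqt.
  have pp0 : phi p = 0.
    by apply/eqP; rewrite eq_le -{1}pt0 phi_nd ?phi_ge0//; lra.
  by rewrite EE// pp0 ?expr0n ?mul0e ?mul0r ?add0e ?add0r.
have D_le r : s <= r <= t -> (D r <= D s)%E.
  move=> srt; apply: bulk_energy_antitone => //.
  - by have [] := K_cont s sst.
  - by have [] := K_cont r srt.
  - case/andP: srt => sr rt; exact: (ha s r s0 sr (le_trans rt t1)).2.
have [Doo|Doo] := eqVneq (D s) +oo%E.
  left; rewrite EE ?lexx ?(ltW st)// Doo mulry gtr0_sg ?mul1e ?addye//.
  by rewrite exprn_gt0// lt_def pt0.
have Dfin r : s <= r <= t -> D r \is a fin_num.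
  move=> srt; rewrite ge0_fin_numE ?bulk_energy_ge0//.
  by apply: le_lt_trans (D_le r srt) _; rewrite ltey.
right; exists (fine \o D); split.
  by move=> r srt /=; rewrite fine_le ?Dfin ?D_le//; lra.
by move=> p q spt sqt; rewrite EE// -[D q]fineK ?Dfin// -EFinM -EFinD.
Qed.
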